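(* Let $\mathcal{S}$ be the set of sequentially congruent partitions and let $\mathcal{P}_{\square}$ be the set of partitions whose parts are all perfect squares. Then there is a (natural) bijection between $\mathcal{S}$ and $\mathcal{P}_{\square}$. Moreover, let $p_{\mathcal{S}}(n)$ be the number of sequentially congruent partitions of size $n$ and $p_{\square}(n)$ the number of partitions of $n$ all of whose parts are perfect squares. Then for all integers $n\geq 1$, $$p_{\mathcal{S}}(n) = p_{\square}(n).$$
   Context: A partition is a finite weakly decreasing sequence of positive integers $\lambda=(\lambda_1,\lambda_2,\dots,\lambda_r)$, $\lambda_1\geq\lambda_2\geq\cdots\geq\lambda_r\geq 1$; its size is $|\lambda|=\lambda_1+\cdots+\lambda_r$, and $\lambda$ is a partition of $n$ if $|\lambda|=n$. A partition $\lambda=(\lambda_1,\dots,\lambda_r)$ is sequentially congruent if (1) $\lambda_i\equiv\lambda_{i+1}\pmod{i}$ for $1\leq i\leq r-1$, and (2) $\lambda_r\equiv 0\pmod{r}$. The perfect squares here are the positive ones $1^2,2^2,3^2,\dots$. The empty partition (of size $0$) is regarded as belonging to both $\mathcal{S}$ and $\mathcal{P}_{\square}$. The word ''natural'' is informal and carries no technical meaning. *)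

(* Defs.v *)
From HB Require Import structures.
From mathcomp Require Import all_boot.

Set Implicit Arguments.
Unset Strict Implicit.
Unset Printing Implicit Defensive.

Definition is_partition (la : seq nat) : bool :=
  sorted geq la && all (leq 1) la.

(* Parts are numbered from 1: [part la i] is lambda_i for 1 <= i <= size la. *)
Definition part (la : seq nat) (i : nat) : nat := nth 0 la i.-1.

(* For the empty sequence the second condition reads 0 = 0 %[mod 0], so the
   empty partition is sequentially congruent. *)
Definition seq_congruent (la : seq nat) : bool :=
  let r := size la in
  all (fun i => part la i == part la i.+1 %[mod i]) (iota 1 r.-1)
  && (part la r == 0 %[mod r]).

Definition pos_square (m : nat) : bool :=
  has (fun k => m == k ^ 2) (iota 1 m).

Lemma pos_squareP (m : nat) :
  reflect (exists2 k, 0 < k & m = k ^ 2) (pos_square m).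
Proof.
apply: (iffP hasP) => [[k] | [k k_gt0 Em]].
  by rewrite mem_iota => /andP[k_gt0 _] /eqP Em; exists k.
exists k; last exact/eqP.
by rewrite mem_iota k_gt0 add1n ltnS Em -mulnn leq_pmulr.
Qed.

Definition square_parts (la : seq nat) : bool := all pos_square la.

Definition seqcong_partition : Type :=
  {la : seq nat | is_partition la && seq_congruent la}.

Definition square_partition : Type :=
  {la : seq nat | is_partition la && square_parts la}.

Record partition_of (n : nat) : Type := PartitionOf {
  partval :> seq nat;
  _ : is_partition partval && (sumn partval == n)
}.

HB.instance Definition _ n := [isSub for @partval n].
HB.instance Definition _ n := [Countable of partition_of n by <:].

(* A partition of n has at most n parts, each at most n, hence embeds into the
   finite type of sequences of length at most n over {0, ..., n}. *)
Lemma size_partition_of n (la : partition_of n) : size (val la) <= n.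
Proof.
case: la => s /= /andP[/andP[_ +] /eqP <-].
elim: s => //= x s IHs /andP[x_gt0 /IHs]; rewrite -add1n; exact: leq_add.
Qed.

Lemma part_partition_of n (la : partition_of n) : all (geq n) (val la).
Proof.
case: la => s /= /andP[_ /eqP <-]; apply/allP => x.
elim: s => //= y s IHs; rewrite inE => /predU1P[-> | /IHs]; first exact: leq_addr.
by move/leq_trans; apply; apply: leq_addl.
Qed.

Definition partition_of_bseq n (la : partition_of n) : n.-bseq 'I_n.+1 :=
  insub_bseq n (map inord (val la)).

Lemma partition_of_bseqK n :
  pcancel (@partition_of_bseq n)
          (fun t => insub (map val (val t)) : option (partition_of n)).
Proof.
move=> la; rewrite /partition_of_bseq /insub_bseq insubdK; last first.
  by rewrite -topredE /= size_map size_partition_of.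
rewrite -map_comp (_ : map _ _ = val la) ?valK //.
apply/map_id_in => x /(allP (part_partition_of la)) /= le_xn.
by rewrite inordK.
Qed.

HB.instance Definition _ n : isFinite (partition_of n) :=
  PCanIsFinite (@partition_of_bseqK n).

Definition p_seqcong (n : nat) : nat :=
  #|[set la : partition_of n | seq_congruent la]|.

Definition p_square (n : nat) : nat :=
  #|[set la : partition_of n | square_parts la]|.

(* Main.v *)
Require Import Defs.
From mathcomp Require Import all_boot.
From mathcomp Require Import zify.

(** A sequentially congruent partition is determined by its quotients
    [m_i = (lambda_i - lambda_(i+1)) / i], where [lambda_(r+1) = 0]; these are
    natural numbers subject only to [m_r > 0].  Reading [m_i] as the multiplicity
    of the part [i] gives an arbitrary partition [nu] ([gap_parts]), and [la]
    is recovered by telescoping: [lambda_i] is the sum of the parts of [nu]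
    that are at least [i] ([tail_sums]).  Squaring every part of [nu] then
    yields a partition into squares.

    Summation by parts shows that the size is preserved:
    [sum lambda_i = sum i * (lambda_i - lambda_(i+1)) = sum i ^ 2 * m_i]
    ([sumn_sq_gap_parts]).  The bijection therefore restricts to the partitions
    of each fixed [n].

    All the inductions run along [la], and dropping the first part shifts the
    indices by one.  Hence each notion takes the index [i] of the first entry
    as a parameter; [i = 1] is the case of interest. *)

Set Implicit Arguments.
Unset Strict Implicit.
Unset Printing Implicit Defensive.

(** * Sequential congruence along a suffix *)

(** The default value [0] of [head] is [lambda_(r+1)]; it merges the condition
    on the last part into the chain of congruences. *)
Fixpoint congruent_from (i : nat) (s : seq nat) : bool :=
  if s is x :: s' then (x == head 0 s' %[mod i]) && congruent_from i.+1 s'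
  else true.

Lemma congruent_from_nth i s :
  congruent_from i s =
  all (fun j => nth 0 s j == nth 0 s j.+1 %[mod i + j]) (iota 0 (size s)).
Proof.
elim: s i => //= x s IHs i; rewrite addn0 nth0 IHs; congr (_ && _).
rewrite (iotaDl 1) all_map; apply: eq_all => j /=.
by rewrite addnCA add1n.
Qed.

Lemma seq_congruentE la : seq_congruent la = congruent_from 1 la.
Proof.
case: la => [|x s] //.
rewrite congruent_from_nth /seq_congruent [size _]/= -[in iota 0 _]addn1 iotaD all_cat.
congr (_ && _); last by rewrite /= andbT [nth 0 s _]nth_default // add1n.
by rewrite (iotaDl 1) all_map.
Qed.

Lemma sorted_cons_head x s :
  sorted geq (x :: s) = (head 0 s <= x) && sorted geq s.
Proof. by case: s. Qed.

Lemma geq_trans : transitive geq.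
Proof. by move=> a b c /= le_ab le_ca; apply: leq_trans le_ca le_ab. Qed.

(** * From congruent partitions to arbitrary partitions *)

Fixpoint gap_parts (i : nat) (s : seq nat) : seq nat :=
  if s is x :: s' then gap_parts i.+1 s' ++ nseq ((x - head 0 s') %/ i) i
  else [::].

Lemma gap_parts_geq i s : all (leq i) (gap_parts i s).
Proof.
elim: s i => //= x s IHs i; rewrite all_cat all_nseq leqnn orbT andbT.
by apply: sub_all (IHs i.+1) => k /ltnW.
Qed.

Lemma sorted_gap_parts i s : sorted geq (gap_parts i s).
Proof.
elim: s i => //= x s IHs i.
rewrite (sorted_pairwise geq_trans) pairwise_cat -!(sorted_pairwise geq_trans) IHs /=.
apply/andP; split.
  apply/allrelP => a b /(allP (gap_parts_geq _ _)) lt_ia.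
  by rewrite mem_nseq => /andP[_ /eqP->]; apply: ltnW.
by elim: (_ %/ _) => // -[|n] //= ->; rewrite leqnn.
Qed.

Lemma gap_divK i x y :
  y <= x -> x == y %[mod i] -> (x - y) %/ i * i = x - y.
Proof. by move=> le_yx; rewrite eqn_mod_dvd // => /divnK. Qed.

(** The first entry telescopes into the weighted gaps that follow it. *)
Lemma sumn_gap_parts i s :
  sorted geq s -> congruent_from i s -> sumn (gap_parts i s) = head 0 s.
Proof.
elim: s i => // x s IHs i; rewrite sorted_cons_head => /andP[le_x s_sorted].
move=> /= /andP[x_mod s_cong].
by rewrite sumn_cat IHs // sumn_nseq mulnC gap_divK // subnKC.
Qed.

(** Summation by parts.  The correction term is the share of the gaps that
    would be carried by the [i.-1] entries missing in front of [s]. *)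
Lemma sumn_sq_gap_parts i s :
  0 < i -> sorted geq s -> congruent_from i s ->
  sumn [seq k ^ 2 | k <- gap_parts i s] = sumn s + i.-1 * head 0 s.
Proof.
elim: s i => [|x s IHs] i i_gt0; first by rewrite muln0.
rewrite sorted_cons_head => /andP[le_x s_sorted] /= /andP[x_mod s_cong].
rewrite map_cat sumn_cat IHs //= map_nseq sumn_nseq.
have := gap_divK le_x x_mod; set m := _ %/ _; set y := head 0 s in le_x *.
move=> Em; have -> : x = y + m * i by rewrite Em subnKC.
by case: i i_gt0 {x_mod s_cong m Em} (m) => // i _ m /=; nia.
Qed.

(** The last gap does not vanish since the last entry is positive; so the
    largest part remembers how many entries there were. *)
Lemma head_gap_parts i s :
  s != [::] -> 0 < i -> sorted geq s -> all (leq 1) s -> congruent_from i s ->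
  head 0 (gap_parts i s) = i.-1 + size s.
Proof.
elim: s i => // x [|y s] IHs i _ i_gt0.
  move=> _ /= /andP[x_gt0 _] /andP[x_mod _].
  rewrite subn0; have := gap_divK (leq0n x) x_mod; rewrite subn0.
  by case: (x %/ i) => [|m _] /=; lia.
rewrite sorted_cons_head => /andP[_ s_sorted] /andP[_ s_pos] /andP[_ s_cong].
have /= := IHs i.+1 isT isT s_sorted s_pos s_cong.
set t := _ ++ _; rewrite -/(gap_parts i.+1 (y :: s)) => Et.
suff -> : head 0 (t ++ nseq ((x - y) %/ i) i) = head 0 t by rewrite Et; lia.
by case: t Et => //=; lia.
Qed.

(** * From arbitrary partitions to congruent partitions *)

Definition tail_sums (i n : nat) (nu : seq nat) : seq nat :=
  [seq sumn [seq k <- nu | j <= k] | j <- iota i n].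

Lemma tail_sumsS i n nu :
  tail_sums i n.+1 nu = sumn [seq k <- nu | i <= k] :: tail_sums i.+1 n nu.
Proof. by []. Qed.

Lemma tail_sums_filter i n nu :
  tail_sums i n [seq k <- nu | i <= k] = tail_sums i n nu.
Proof.
apply/eq_in_map => j; rewrite mem_iota => /andP[le_ij _].
rewrite -filter_predI; congr sumn; apply: eq_filter => k /=.
by case: leqP => // /(leq_trans le_ij).
Qed.

(** For [n = 0] the bound on the parts makes the sum empty, in agreement with
    the default value of [head]; this is where the last part fits in. *)
Lemma head_tail_sums i n nu :
  all (gtn (i + n)) nu ->
  head 0 (tail_sums i n nu) = sumn [seq k <- nu | i <= k].
Proof.
case: n => // /allP nu_lt; rewrite (_ : filter _ _ = [::]) //.
apply/eqP; rewrite -(negbK (_ == _)) -has_filter; apply/hasPn => k /nu_lt /=.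
by rewrite addn0 -ltnNge.
Qed.

(** Consecutive tail sums differ by the contribution of the parts equal to
    [i], a multiple of [i]: this gives the congruences, and the quotient is the
    multiplicity that [gap_parts] reads off. *)
Lemma sumn_filter_leqS i nu :
  sumn [seq k <- nu | i <= k] =
  sumn [seq k <- nu | i < k] + count_mem i nu * i.
Proof. by elim: nu => //= k nu IHnu; case: (ltngtP i k) => [||<-] /=; lia. Qed.

Lemma sorted_tail_sums i n nu : sorted geq (tail_sums i n nu).
Proof.
elim: n i => // n IHn i; rewrite tail_sumsS sorted_cons_head IHn andbT.
by case: n {IHn} => //= n; rewrite (sumn_filter_leqS i) leq_addr.
Qed.

Lemma congruent_tail_sums i n nu :
  all (gtn (i + n)) nu -> congruent_from i (tail_sums i n nu).
Proof.
elim: n i => // n IHn i; rewrite -addSnnS tail_sumsS /= => nu_lt.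
by rewrite IHn // head_tail_sums // sumn_filter_leqS addnC modnMDl eqxx.
Qed.

Lemma tail_sums_gt0 i n nu :
  0 < i -> (i + n).-1 \in nu -> all (leq 1) (tail_sums i n nu).
Proof.
move=> i_gt0 nu_max; apply/allP => _ /mapP[j + ->]; rewrite mem_iota => j_in.
have : (i + n).-1 \in [seq k <- nu | j <= k] by rewrite mem_filter nu_max; lia.
elim: (filter _ _) => //= k s IHs; rewrite inE => /predU1P[<- | /IHs]; lia.
Qed.

(** * The two constructions are mutually inverse *)

Lemma gap_partsK i s :
  sorted geq s -> congruent_from i s ->
  tail_sums i (size s) (gap_parts i s) = s.
Proof.
elim: s i => // x s IHs i xs_sorted xs_cong.
rewrite tail_sumsS (all_filterP (gap_parts_geq _ _)) sumn_gap_parts //=.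
move: xs_sorted xs_cong; rewrite sorted_cons_head => /andP[_ ?] /= /andP[_ ?].
(* The copies of [i] do not enter the sums with lower bound [i.+1]. *)
rewrite -tail_sums_filter filter_cat filter_nseq ltnn cats0.
by rewrite tail_sums_filter IHs.
Qed.

Lemma sorted_geq_split i nu :
  sorted geq nu -> all (leq i) nu ->
  nu = [seq k <- nu | i < k] ++ nseq (count_mem i nu) i.
Proof.
elim: nu => // k nu IHnu nu_sorted /= /andP[le_ik nu_ge].
have /andP[nu_le {}nu_sorted] : all (geq k) nu && sorted geq nu.
  by move: nu_sorted; rewrite /= (path_sortedE geq_trans).
case: ltngtP le_ik => // [_ _ | Eik _]; first by rewrite /= {1}IHnu.
(* Once the lower bound [i] is reached, the rest is constant. *)
subst k.
have nuE : nu = nseq (size nu) i.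
  apply/all_pred1P/allP => k k_in /=.
  by apply/eqP/anti_leq; rewrite (allP nu_ge k k_in) andbT; apply: (allP nu_le).
by rewrite nuE filter_nseq count_nseq ltnn /= eqxx mul1n.
Qed.

Lemma tail_sumsK i n nu :
  0 < i -> sorted geq nu -> all (leq i) nu -> all (gtn (i + n)) nu ->
  gap_parts i (tail_sums i n nu) = nu.
Proof.
elim: n i nu => [|n IHn] i nu i_gt0 nu_sorted nu_ge nu_lt.
  case: nu nu_ge nu_lt {nu_sorted} => //= k nu /andP[le_ik _] /andP[].
  by rewrite addn0 ltnNge le_ik.
rewrite -addSnnS in nu_lt.
rewrite tail_sumsS /= head_tail_sums // sumn_filter_leqS addKn mulnK //.
rewrite -tail_sums_filter IHn //; last 2 first.
- exact: filter_all.
- by rewrite all_filter; apply: sub_all nu_lt => k /= ->; rewrite implybT.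
- by rewrite -sorted_geq_split.
exact: (sorted_filter geq_trans).
Qed.

(** * The bijection with partitions into squares *)

(** The square root, searched in the list of squares; meaningful on squares
    only. *)
Definition sq_root (m : nat) : nat := index m [seq k ^ 2 | k <- iota 0 m.+1].

Lemma sq_rootK k : sq_root (k ^ 2) = k.
Proof.
have sq_inj : injective (expn^~ 2).
  by move=> a b /eqP; rewrite /= eqn_exp2r // => /eqP.
rewrite /sq_root (index_map sq_inj).
have lt_k : k < (k ^ 2).+1 by rewrite ltnS -mulnn; case: k => // k; apply: leq_pmulr.
by rewrite -[X in index X _](nth_iota 0 0 lt_k) index_uniq ?size_iota ?iota_uniq.
Qed.

Definition to_squares (la : seq nat) : seq nat :=
  [seq k ^ 2 | k <- gap_parts 1 la].

Definition of_squares (mu : seq nat) : seq nat :=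
  let nu := [seq sq_root m | m <- mu] in tail_sums 1 (head 0 nu) nu.

Definition seqcong_pred : pred (seq nat) :=
  fun la => is_partition la && seq_congruent la.

Definition square_pred : pred (seq nat) :=
  fun mu => is_partition mu && square_parts mu.

Lemma is_partition_sq nu :
  is_partition [seq k ^ 2 | k <- nu] = is_partition nu.
Proof.
rewrite /is_partition sorted_map all_map; congr (_ && _).
  by case: nu => //= k nu; apply: eq_path => a b /=; rewrite leq_exp2r.
by apply: eq_all => k /=; rewrite expn_gt0 orbF.
Qed.

Lemma square_predP mu :
  reflect (exists2 nu, is_partition nu & mu = [seq k ^ 2 | k <- nu])
          (square_pred mu).
Proof.
apply: (iffP andP) => [[mu_part mu_sq] | [nu nu_part ->]].
  have muE : mu = [seq k ^ 2 | k <- map sq_root mu].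
    rewrite -map_comp [LHS](esym (map_id _)); apply/eq_in_map => m.
    by move=> /(allP mu_sq) /pos_squareP[k _ ->] /=; rewrite sq_rootK.
  by exists (map sq_root mu); rewrite // -is_partition_sq -muE.
rewrite is_partition_sq; split=> //; apply/allP => _ /mapP[k k_in ->].
apply/pos_squareP; exists k => //.
by case/andP: nu_part => _ /allP/(_ k k_in).
Qed.

Lemma of_squares_sq nu :
  of_squares [seq k ^ 2 | k <- nu] = tail_sums 1 (head 0 nu) nu.
Proof. by rewrite /of_squares -map_comp (eq_map sq_rootK) map_id. Qed.

Lemma sorted_all_head nu : sorted geq nu -> all (gtn (1 + head 0 nu)) nu.
Proof.
by case: nu => //= k nu; rewrite (path_sortedE geq_trans) add1n ltnS leqnn => /andP[].
Qed.

Lemma to_squares_pred la : square_pred (to_squares la).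
Proof.
apply/square_predP; exists (gap_parts 1 la) => //.
by rewrite /is_partition sorted_gap_parts gap_parts_geq.
Qed.

Lemma of_squares_pred mu : square_pred mu -> seqcong_pred (of_squares mu).
Proof.
move=> /square_predP[nu /andP[nu_sorted nu_pos] ->]; rewrite of_squares_sq.
rewrite /seqcong_pred /is_partition sorted_tail_sums seq_congruentE /=.
rewrite congruent_tail_sums ?sorted_all_head // andbT.
case: nu {nu_sorted nu_pos} => // k nu.
by apply: tail_sums_gt0; rewrite //= inE eqxx.
Qed.

Lemma to_squaresK : {in seqcong_pred, cancel to_squares of_squares}.
Proof.
move=> la /andP[/andP[la_sorted la_pos]].
rewrite seq_congruentE of_squares_sq => la_cong.
case: (la =P [::]) => [->|/eqP la_neq0] //.
by rewrite head_gap_parts // add0n gap_partsK.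
Qed.

Lemma of_squaresK : {in square_pred, cancel of_squares to_squares}.
Proof.
move=> mu /square_predP[nu /andP[nu_sorted nu_pos] ->].
by rewrite of_squares_sq /to_squares tail_sumsK // sorted_all_head.
Qed.

Lemma sumn_to_squares la : seqcong_pred la -> sumn (to_squares la) = sumn la.
Proof.
move=> /andP[/andP[la_sorted _]]; rewrite seq_congruentE => la_cong.
by rewrite /to_squares sumn_sq_gap_parts // addn0.
Qed.

Lemma sumn_of_squares mu : square_pred mu -> sumn (of_squares mu) = sumn mu.
Proof.
by move=> mu_sq; rewrite -sumn_to_squares ?of_squares_pred // of_squaresK.
Qed.

(** * Transfer to sigma types and to cardinals *)

Lemma sig_bijective (T U : Type) (P : pred T) (Q : pred U)
    (f : T -> U) (g : U -> T) :
  (forall x, P x -> Q (f x)) -> (forall y, Q y -> P (g y)) ->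
  {in P, cancel f g} -> {in Q, cancel g f} ->
  exists h : {x | P x} -> {y | Q y}, bijective h.
Proof.
move=> fPQ gQP fK gK.
exists (fun x => exist Q (f (val x)) (fPQ _ (valP x))).
exists (fun y => exist P (g (val y)) (gQP _ (valP y))) => x;
  apply: val_inj; [exact: fK (valP x) | exact: gK (valP x)].
Qed.

(** An injection that preserves sizes bounds one count by the other; used in
    both directions, it gives the equality. *)
Lemma leq_card_partition_of n (P Q : pred (seq nat)) (f g : seq nat -> seq nat) :
  (forall la, is_partition la && P la -> is_partition (f la) && Q (f la)) ->
  (forall la, is_partition la && P la -> sumn (f la) = sumn la) ->
  {in [pred la | is_partition la && P la], cancel f g} ->
  #|[set la : partition_of n | P la]| <= #|[set la : partition_of n | Q la]|.
Proof.
move=> fPQ f_sum fK.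
(* The default value [la] is never taken where [P] holds. *)
pose F (la : partition_of n) : partition_of n := insubd la (f la).
have inP (la : partition_of n) : P la -> is_partition la && P la.
  by move=> ->; case: la => la /= /andP[->].
have FE (la : partition_of n) : P la -> partval (F la) = f la.
  move=> /inP la_P; rewrite [LHS]val_insubd f_sum //.
  have /andP[-> _] := fPQ _ la_P.
  by case: la {la_P} => la /= /andP[_ ->].
have F_inj : {in [set la : partition_of n | P la] &, injective F}.
  move=> la mu; rewrite !inE => la_P mu_P /(congr1 (@partval n)).
  rewrite !FE // => /(congr1 g).
  by rewrite (fK _ (inP _ la_P)) (fK _ (inP _ mu_P)); apply: val_inj.
rewrite -(card_in_imset F_inj); apply/subset_leq_card/subsetP => _ /imsetP[la + ->].
by rewrite !inE => la_P; rewrite FE //; case/andP: (fPQ _ (inP _ la_P)).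
Qed.

Theorem theorem1p2 :
  (exists f : seqcong_partition -> square_partition, bijective f) /\
  (forall n : nat, 1 <= n -> p_seqcong n = p_square n).
Proof.
split.
  apply: sig_bijective of_squares_pred to_squaresK of_squaresK => la _.
  exact: to_squares_pred.
move=> n _; apply/eqP; rewrite eqn_leq; apply/andP; split.
  apply: (@leq_card_partition_of n seq_congruent square_parts).
  - by move=> la _; apply: to_squares_pred.
  - exact: sumn_to_squares.
  - exact: to_squaresK.
apply: (@leq_card_partition_of n square_parts seq_congruent).
- exact: of_squares_pred.
- exact: sumn_of_squares.
- exact: of_squaresK.
Qed.
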